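(* Let $k$ be a commutative ring, $A$ a commutative $k$-algebra, $R$ a $k$-algebra over $A$, and $\Psi=\{\Psi^p_\Delta\}$ an HS-structure on $R$ over $A/k$. Let $\nabla:\mathrm{Der}_k(A)\to R$ be the map determined by $\Psi^1_{\{0,1\}}(\mathrm{Id}+\delta s)=1+\nabla(\delta)s$ for all $\delta\in \mathrm{Der}_k(A)$. Then for each integer $p\ge 1$, each non-empty co-ideal $\Delta\subset\mathbb{N}^p$ and each $D\in \mathrm{HS}^p_k(A;\Delta)$, one has $$\varepsilon\big(\Psi^p_\Delta(D)\big)=\overline{\nabla}\big(\varepsilon(D)\big)\quad\text{in } R[[\mathbf{s}]]_{\Delta,+},$$ where $\mathbf{s}=\{s_1,\dots,s_p\}$ and $\overline{\nabla}:\mathrm{Der}_k(A)[[\mathbf{s}]]_{\Delta,+}\to R[[\mathbf{s}]]_{\Delta,+}$ is the map $\overline{\nabla}\left(\sum_\alpha\delta_\alpha\mathbf{s}^\alpha\right)=\sum_\alpha\nabla(\delta_\alpha)\mathbf{s}^\alpha$.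
   Context: Throughout, $k$ is a commutative ring and $A$ a commutative $k$-algebra; $\mathbb{N}=\{0,1,2,\dots\}$; $\mathbf{s}=\{s_1,\dots,s_p\}$, $\mathbf{t}=\{t_1,\dots,t_q\}$ are sets of variables (for $p=1$ the variable is written $s$). Co-ideals and truncated series. $\mathbb{N}^p$ has the componentwise partial order and $|\alpha|=\alpha_1+\cdots+\alpha_p$. A co-ideal of $\mathbb{N}^p$ is a subset $\Delta$ such that $\alpha\in\Delta$, $\alpha'\le\alpha$ imply $\alpha'\in\Delta$. For an abelian group $M$ and a non-empty co-ideal $\Delta$, $M[[\mathbf{s}]]_\Delta$ is the quotient of $M[[\mathbf{s}]]$ by the series with $m_\alpha=0$ for all $\alpha\in\Delta$; its elements are written $\sum_{\alpha\in\Delta}m_\alpha\mathbf{s}^\alpha$. $M[[\mathbf{s}]]_{\Delta,+}$ is the subgroup of those with $m_0=0$. If $R$ is a ring, $R[[\mathbf{s}]]_\Delta$ is a ring (the variables are central), and $\mathcal{U}^p(R;\Delta)$ is the multiplicative group of $r\in R[[\mathbf{s}]]_\Delta$ with $r_0=1$; the inverse of $r$ is denoted $r^*$. A $k$-algebra over $A$ is a not necessarily commutative $k$-algebra $R$ with a $k$-algebra map $\iota:A\to R$; elements of $A$ act on $R$ on both sides through $\iota$, and $a\in A$ is also written for $\iota(a)$. Substitution maps. A substitution map $\varphi:A[[\mathbf{s}]]_\Delta\to A[[\mathbf{t}]]_\Omega$ (with $\Delta\subset\mathbb{N}^p$, $\Omega\subset\mathbb{N}^q$ non-empty co-ideals)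 is an $A$-algebra map such that each $\varphi(s_i)$ has zero constant term. For $r=\sum r_\alpha\mathbf{s}^\alpha\in R[[\mathbf{s}]]_\Delta$, $\varphi\bullet r:=\sum_\alpha\varphi(\mathbf{s}^\alpha)r_\alpha\in R[[\mathbf{t}]]_\Omega$. Hasse–Schmidt derivations. $\mathrm{HS}^p_k(A;\Delta)$ is the set of families $D=(D_\alpha)_{\alpha\in\Delta}$ of $k$-linear maps $D_\alpha:A\to A$ with $D_0=\mathrm{Id}$ and $D_\alpha(xy)=\sum_{\beta+\gamma=\alpha}D_\beta(x)D_\gamma(y)$. Identifying $D$ with $\sum_{\alpha\in\Delta}D_\alpha\mathbf{s}^\alpha$, it is a subgroup of $\mathcal{U}^p(\mathrm{End}_k(A);\Delta)$, and $\varphi\bullet D\in\mathrm{HS}^q_k(A;\Omega)$ for every substitution map $\varphi:A[[\mathbf{s}]]_\Delta\to A[[\mathbf{t}]]_\Omega$ with $\Delta\subset\mathbb{N}^p$, $\Omega\subset\mathbb{N}^q$ non-empty co-ideals (known). In particular $\mathrm{HS}^1_k(A;\{0,1\})=\{\mathrm{Id}+\delta s:\delta\in\mathrm{Der}_k(A)\}$. HS-structures. An HS-structure on a $k$-algebra $R$ over $A$ (over $A/k$) is a system of maps $\Psi^p_\Delta:\mathrm{HS}^p_k(A;\Delta)\to\mathcal{U}^p(R;\Delta)$, for $p\in\mathbb{N}$ and $\Delta\subset\mathbb{N}^p$ a non-empty co-ideal, such that: (i) each $\Psi^p_\Delta$ is a group homomorphism; (ii) $\Psi^p_\Delta(D)\,a=\left(\sum_{\alpha\in\Delta}D_\alpha(a)\mathbf{s}^\alpha\right)\Psi^p_\Delta(D)$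 for all $D\in\mathrm{HS}^p_k(A;\Delta)$, $a\in A$; (iii) $\Psi^q_\Omega(\varphi\bullet D)=\varphi\bullet\Psi^p_\Delta(D)$ for every substitution map $\varphi:A[[\mathbf{s}]]_\Delta\to A[[\mathbf{t}]]_\Omega$ and every $D\in\mathrm{HS}^p_k(A;\Delta)$. The map $\varepsilon$. For a ring $R$ and $r=\sum r_\alpha\mathbf{s}^\alpha\in\mathcal{U}^p(R;\Delta)$, $\varepsilon(r):=r^*\,\boldsymbol\chi(r)\in R[[\mathbf{s}]]_{\Delta,+}$, where $\boldsymbol\chi\left(\sum_\alpha r_\alpha\mathbf{s}^\alpha\right)=\sum_\alpha|\alpha|\,r_\alpha\mathbf{s}^\alpha$. For $D\in\mathrm{HS}^p_k(A;\Delta)\subset\mathcal{U}^p(\mathrm{End}_k(A);\Delta)$ it is known that $\varepsilon(D)\in\mathrm{Der}_k(A)[[\mathbf{s}]]_{\Delta,+}$. *)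

(* Defs.v *)
From HB Require Import structures.
From mathcomp Require Import all_boot all_order all_algebra.
From mathcomp Require Import boolp.
From mathcomp Require Import mpoly.

Set Implicit Arguments.
Unset Strict Implicit.
Unset Printing Implicit Defensive.

Import GRing.Theory.
Local Open Scope ring_scope.

(* Algebras are rings with a central structure morphism.  The library's
   [algType] is not used because it requires 1 != 0, whereas the zero ring is
   allowed as [k], as [A] and as [R]. *)
HB.mixin Record hasStructMap (k : pzRingType) A of GRing.PzRing A := {
  stmap : {rmorphism k -> A};
  stmap_central : forall (c : k) (x : A), stmap c * x = x * stmap c
}.

#[short(type="pzAlgType")]
HB.structure Definition PzAlgebra (k : pzRingType) :=
  {A of GRing.PzRing A & hasStructMap k A}.

#[short(type="comPzAlgType")]
HB.structure Definition ComPzAlgebra (k : pzRingType) :=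
  {A of PzAlgebra k A & GRing.ComPzRing A}.

HB.mixin Record isStructMapMorphism (k : pzRingType) (A B : pzAlgType k)
    (f : A -> B) := {
  fstmap : forall c : k, f (stmap c) = stmap c
}.

HB.structure Definition AlgMorphism (k : pzRingType) (A B : pzAlgType k) :=
  {f of @GRing.RMorphism A B f & isStructMapMorphism k A B f}.

Notation "{ 'algmorphism' A -> B }" := (AlgMorphism.type A%type B%type)
  (at level 0, A at level 98, B at level 99,
   format "{ 'algmorphism'  A  ->  B }") : type_scope.

(* Sum over all decompositions [i + j = m] of a multi-index. *)
Definition csum (p : nat) (M : nmodType) (m : 'X_{1..p})
    (F : 'X_{1..p} -> 'X_{1..p} -> M) : M :=
  \sum_(ij : 'X_{1..p < (mdeg m).+1, (mdeg m).+1} | m == (ij.1 + ij.2)%MM)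
     F ij.1 ij.2.

Section ConvolutionSums.
Variables (p : nat) (M : nmodType).
Implicit Types (m i j : 'X_{1..p}) (F G : 'X_{1..p} -> 'X_{1..p} -> M).

Lemma big_bound (P : pred 'X_{1..p}) (F : 'X_{1..p} -> M) N N' :
    (forall i, P i -> (mdeg i < N)%N) -> (forall i, P i -> (mdeg i < N')%N) ->
  \sum_(i : 'X_{1..p < N} | P i) F i = \sum_(i : 'X_{1..p < N'} | P i) F i.
Proof.
move=> PN PN'.
have E K : \sum_(i : 'X_{1..p < K} | P i) F i =
    \sum_(i <- [seq i <- [seq val i | i : 'X_{1..p < K}] | P i]) F i.
  by rewrite big_filter big_map big_enum_cond; apply: eq_bigl => i; rewrite inE.
rewrite !E; apply: perm_big; apply: uniq_perm.
- by rewrite filter_uniq // map_inj_uniq ?enum_uniq //; apply: val_inj.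
- by rewrite filter_uniq // map_inj_uniq ?enum_uniq //; apply: val_inj.
move=> i; rewrite !mem_filter; case Pi: (P i) => //=.
have mem K : (mdeg i < K)%N -> i \in [seq val i | i : 'X_{1..p < K}].
  by move=> iK; apply/mapP; exists (BMultinom iK); rewrite ?mem_enum.
by rewrite !mem // ?PN ?PN'.
Qed.

Lemma csumE m F N : (mdeg m < N)%N ->
  csum m F =
  \sum_(i : 'X_{1..p < N}) \sum_(j : 'X_{1..p < N} | m == (i + j)%MM) F i j.
Proof.
move=> mN; rewrite /csum.
have sub K : (mdeg m < K)%N ->
    \sum_(i : 'X_{1..p < K}) \sum_(j : 'X_{1..p < K} | m == (i + j)%MM) F i j =
    \sum_(i : 'X_{1..p < K} | (i <= m)%MM) F i (m - i)%MM.
  move=> mK; rewrite [RHS]big_mkcond /=; apply: eq_bigr => i _.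
  have mi : (mdeg (m - i) < K)%N by apply: leq_ltn_trans (mdegB _ _) mK.
  case: ifP => [im | /negbT nim].
    rewrite (big_pred1 (BMultinom mi)) //= => j.
    rewrite -[RHS]/(j == _) bmeqP /=; apply/eqP/eqP => [->|->]; last by rewrite addmC submK.
    by rewrite [X in (X - _)%MM]addmC addmK.
  rewrite big_pred0 // => j; apply/negbTE; apply: contra nim => /eqP->.
  exact: lem_addr.
have lt (i : 'X_{1..p}) K : (mdeg m < K)%N -> (i <= m)%MM -> (mdeg i < K)%N.
  move=> mK im; apply: leq_ltn_trans mK.
  by rewrite -(submK im) mdegD leq_addl.
rewrite sub // (@big_bound (fun i => (i <= m)%MM)
  (fun i => F i (m - i)%MM) N (mdeg m).+1).
- by rewrite -sub // pair_big_dep.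
- by move=> i; apply: lt.
- by move=> i; apply: lt.
Qed.

Lemma eq_csum m F G : (forall i j, m = (i + j)%MM -> F i j = G i j) ->
  csum m F = csum m G.
Proof. by move=> FG; apply: eq_bigr => ij /eqP; apply: FG. Qed.

Lemma csumD m F G : csum m (fun i j => F i j + G i j) = csum m F + csum m G.
Proof. exact: big_split. Qed.

Lemma csum0 m F : (forall i j, m = (i + j)%MM -> F i j = 0) -> csum m F = 0.
Proof. by move=> F0; apply: big1 => ij /eqP; apply: F0. Qed.

Lemma csum_sum (I : finType) (P : pred I) m
    (F : I -> 'X_{1..p} -> 'X_{1..p} -> M) :
  csum m (fun i j => \sum_(a | P a) F a i j) = \sum_(a | P a) csum m (F a).
Proof. exact: exchange_big. Qed.

Lemma csumC m F : csum m F = csum m (fun i j => F j i).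
Proof.
rewrite !(csumE _ (leqnn _)) [RHS](exchange_big_dep predT) //=.
by apply: eq_bigr => i _; apply: eq_bigl => j; rewrite addmC.
Qed.

Lemma csum_delta m i j F :
    (forall a b, m = (a + b)%MM -> (a, b) != (i, j) -> F a b = 0) ->
  csum m F = if m == (i + j)%MM then F i j else 0.
Proof.
move=> F0; case: ifP => [/eqP mE|/eqP mN]; last first.
  apply: csum0 => a b mab; apply: F0 => //; apply/eqP => -[ai bj].
  by apply: mN; rewrite mab ai bj.
have iN : (mdeg i < (mdeg m).+1)%N by rewrite ltnS mE mdegD leq_addr.
have jN : (mdeg j < (mdeg m).+1)%N by rewrite ltnS mE mdegD leq_addl.
rewrite /csum (bigD1 (BMultinom iN, BMultinom jN)) /=; last exact/eqP.
rewrite big1 ?addr0 // => -[a b] /= /andP[/eqP mab ne]; exact: F0.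
Qed.

Lemma csum0l m F : (forall i j, m = (i + j)%MM -> i != 0%MM -> F i j = 0) ->
  csum m F = F 0%MM m.
Proof.
move=> F0; rewrite (@csum_delta m 0%MM m) ?add0m ?eqxx // => a b mab ne.
apply: F0 => //; apply: contra ne => /eqP a0.
by rewrite xpair_eqE a0 mab a0 add0m !eqxx.
Qed.

Lemma csum0r m F : (forall i j, m = (i + j)%MM -> j != 0%MM -> F i j = 0) ->
  csum m F = F m 0%MM.
Proof.
move=> F0; rewrite csumC csum0l // => i j mij; rewrite addmC in mij.
exact: F0.
Qed.

Lemma csumA m (F : 'X_{1..p} -> 'X_{1..p} -> 'X_{1..p} -> M) :
  csum m (fun i c => csum i (fun a b => F a b c)) =
  csum m (fun a j => csum j (fun b c => F a b c)).
Proof.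
set N := (mdeg m).+1.
have inner (x : 'X_{1..p}) (Q : pred 'X_{1..p < N}) (v : M) : (mdeg x < N)%N ->
    (forall i : 'X_{1..p < N}, Q i = (val i == x)) ->
    \sum_(i : 'X_{1..p < N} | Q i) v = v.
  by move=> xN QE; rewrite (big_pred1 (BMultinom xN)).
have lt a b : m = (a + b)%MM -> (mdeg a < N)%N /\ (mdeg b < N)%N.
  by move=> mab; rewrite /N mab !ltnS mdegD leq_addr leq_addl.
transitivity (\sum_(a : 'X_{1..p < N}) \sum_(b : 'X_{1..p < N})
   \sum_(c : 'X_{1..p < N} | m == (a + b + c)%MM) F a b c).
  rewrite (csumE _ (leqnn _)).
  under eq_bigr => i _ do under eq_bigr => c _ do
    rewrite (csumE _ (bmdeg i)).
  under eq_bigr => i _ do rewrite (exchange_big_dep predT) //=.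
  rewrite exchange_big /=; apply: eq_bigr => a _.
  under eq_bigr => i _ do rewrite (exchange_big_dep predT) //=.
  rewrite exchange_big /=; apply: eq_bigr => b _.
  rewrite (exchange_big_dep predT) //= [RHS]big_mkcond; apply: eq_bigr => c _.
  case: (m =P (a + b + c)%MM) => [mE|mN].
    apply: (inner (a + b)%MM); first exact: (lt _ _ mE).1.
    move=> i; apply/andP/eqP => [[_ /eqP]|->]; first by [].
    by rewrite -mE !eqxx.
  rewrite big_pred0 // => i; apply/negbTE/negP => /andP[/andP[/eqP mi _] /eqP iE].
  by apply: mN; apply: (etrans mi); rewrite iE.
rewrite (csumE _ (leqnn _)); apply: eq_bigr => a _.
under [RHS]eq_bigr => j _ do rewrite (csumE _ (bmdeg j)).
rewrite [RHS](exchange_big_dep predT) //=; apply: eq_bigr => b _.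
rewrite [RHS](exchange_big_dep predT) //= big_mkcond; apply: eq_bigr => c _.
case: (m =P (a + b + c)%MM) => [mE|mN].
  have mE' : m = (a + (b + c))%MM by rewrite addmA.
  apply/esym/(inner (b + c)%MM); first exact: (lt _ _ mE').2.
  move=> j; apply/andP/eqP => [[_ /eqP]|->]; first by [].
  by rewrite -mE' !eqxx.
rewrite big_pred0 // => j; apply/negbTE/negP => /andP[/andP[/eqP mj _] /eqP jE].
by apply: mN; apply: (etrans mj); rewrite jE addmA.
Qed.

Lemma csumACA m (F : 'X_{1..p} -> 'X_{1..p} -> 'X_{1..p} -> 'X_{1..p} -> M) :
  csum m (fun i j => csum i (fun a b => csum j (fun c d => F a b c d))) =
  csum m (fun i j => csum i (fun a c => csum j (fun b d => F a b c d))).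
Proof.
rewrite (csumA m (fun a b j => csum j (F a b))).
rewrite (csumA m (fun a c j => csum j (fun b d => F a b c d))).
apply: eq_csum => a r _.
rewrite -(csumA r (F a)) -(csumA r (fun c b => F a b c)).
by apply: eq_csum => i d _; rewrite csumC.
Qed.

End ConvolutionSums.

Lemma raddf_csum (p : nat) (M M' : nmodType) (h : {additive M -> M'})
    (m : 'X_{1..p}) F : h (csum m F) = csum m (fun i j => h (F i j)).
Proof. exact: raddf_sum. Qed.

Record coideal (p : nat) := Coideal {
  coideal_pred :> pred 'X_{1..p};
  coideal_nonempty : exists m, coideal_pred m;
  coideal_down : forall m m', (m' <= m)%MM -> coideal_pred m -> coideal_pred m'
}.

Lemma coideal0 p (Delta : coideal p) : Delta 0%MM.
Proof.
have [m Dm] := coideal_nonempty Delta.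
by apply: coideal_down Dm; apply/mnm_lepP => i; rewrite mnm0E.
Qed.

Lemma coidealD p (Delta : coideal p) m i j :
  m = (i + j)%MM -> Delta m -> Delta i /\ Delta j.
Proof.
by move=> -> Dm; split; apply: coideal_down Dm; rewrite (lem_addr, lem_addl).
Qed.

(* [series Delta M] is M[[s]]_Delta, each class being represented by its family
   of coefficients indexed by the elements of [Delta]; [scoef] extends this
   family by zero outside [Delta]. *)
Definition series (p : nat) (Delta : coideal p) (M : Type) :=
  {m : 'X_{1..p} | Delta m} -> M.

Definition scoef (p : nat) (Delta : coideal p) (M : nmodType)
    (f : series Delta M) (m : 'X_{1..p}) : M :=
  if insub m is Some u then f u else 0.

Definition smap (p : nat) (Delta : coideal p) (M N : Type) (h : M -> N)
    (f : series Delta M) : series Delta N := fun u => h (f u).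

Section SeriesGroup.
Variables (p : nat) (Delta : coideal p).

Lemma scoef_val (M : nmodType) (f : series Delta M) u : scoef f (val u) = f u.
Proof. by rewrite /scoef valK. Qed.

Lemma scoef_out (M : nmodType) (f : series Delta M) m :
  ~~ Delta m -> scoef f m = 0.
Proof. by move=> Dm; rewrite /scoef insubN. Qed.

Lemma scoef_mk (M : nmodType) (g : 'X_{1..p} -> M) m : Delta m ->
  scoef ((fun u => g (val u)) : series Delta M) m = g m.
Proof. by move=> Dm; rewrite /scoef insubT. Qed.

Lemma seriesP (M : nmodType) (f g : series Delta M) :
  (forall m, Delta m -> scoef f m = scoef g m) -> f = g.
Proof.
by move=> fg; apply: funext => u; rewrite -!scoef_val fg //; apply: valP.
Qed.

HB.instance Definition _ (M : choiceType) :=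
  Choice.copy (series Delta M) ({m : 'X_{1..p} | Delta m} -> M).

Variable M : zmodType.
Implicit Types f g h : series Delta M.

Definition sadd f g : series Delta M := fun u => f u + g u.
Definition sopp f : series Delta M := fun u => - f u.
Definition szero : series Delta M := fun=> 0.

Fact saddA : associative sadd.
Proof. by move=> f g h; apply: funext => u; apply: addrA. Qed.
Fact saddC : commutative sadd.
Proof. by move=> f g; apply: funext => u; apply: addrC. Qed.
Fact sadd0 : left_id szero sadd.
Proof. by move=> f; apply: funext => u; apply: add0r. Qed.
Fact saddN : left_inverse szero sopp sadd.
Proof. by move=> f; apply: funext => u; apply: addNr. Qed.

HB.instance Definition _ :=
  GRing.isZmodule.Build (series Delta M) saddA saddC sadd0 saddN.

Lemma scoefD f g m : scoef (f + g) m = scoef f m + scoef g m.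
Proof. by rewrite /scoef; case: insub => //; rewrite addr0. Qed.

Lemma scoefN f m : scoef (- f) m = - scoef f m.
Proof. by rewrite /scoef; case: insub => //; rewrite oppr0. Qed.

Lemma scoef0 m : scoef (0 : series Delta M) m = 0.
Proof. by rewrite /scoef; case: insub. Qed.

Lemma scoef_sum (I : Type) (r : seq I) (P : pred I) (F : I -> series Delta M) m :
  scoef (\sum_(i <- r | P i) F i) m = \sum_(i <- r | P i) scoef (F i) m.
Proof.
by elim/big_rec2: _ => [|i x y _ <-]; rewrite ?scoef0 ?scoefD.
Qed.

End SeriesGroup.

(* The Cauchy product, for an arbitrary pairing of coefficients. *)
Definition sconv (p : nat) (Delta : coideal p) (L M N : zmodType)
    (op : L -> M -> N) (f : series Delta L) (g : series Delta M) :
    series Delta N :=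
  fun u => csum (val u) (fun i j => op (scoef f i) (scoef g j)).

Section SeriesConvolution.
Variables (p : nat) (Delta : coideal p).

Lemma scoef_conv (L M N : zmodType) (op : L -> M -> N)
    (f : series Delta L) (g : series Delta M) m : Delta m ->
  scoef (sconv op f g) m = csum m (fun i j => op (scoef f i) (scoef g j)).
Proof.
exact: (@scoef_mk _ _ _
  (fun m => csum m (fun i j => op (scoef f i) (scoef g j)))).
Qed.

Lemma sconvA (L M N LM MN P : zmodType)
    (o1 : L -> M -> LM) (o2 : LM -> N -> P) (o3 : M -> N -> MN) (o4 : L -> MN -> P)
    (f : series Delta L) (g : series Delta M) (h : series Delta N) :
    (forall x y z, o2 (o1 x y) z = o4 x (o3 y z)) ->
    (forall z, {morph o2^~ z : x y / x + y}) -> (forall z, o2 0 z = 0) ->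
    (forall x, {morph o4 x : y z / y + z}) -> (forall x, o4 x 0 = 0) ->
  sconv o2 (sconv o1 f g) h = sconv o4 f (sconv o3 g h).
Proof.
move=> oA o2D o20 o4D o40; apply: seriesP => m Dm; rewrite !scoef_conv //.
transitivity (csum m (fun i c => csum i (fun a b =>
    o2 (o1 (scoef f a) (scoef g b)) (scoef h c)))).
  apply: eq_csum => i j mij; rewrite scoef_conv ?(coidealD mij Dm).1 //.
  by rewrite /csum (big_morph _ (o2D _) (o20 _)).
rewrite csumA; apply: eq_csum => i j mij.
rewrite scoef_conv ?(coidealD mij Dm).2 //.
rewrite /csum (big_morph _ (o4D _) (o40 _)).
by apply: eq_bigr => ab _; apply: oA.
Qed.

Lemma sconvDl (L M N : zmodType) (op : L -> M -> N) f1 f2 (g : series Delta M) :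
    (forall z, {morph op^~ z : x y / x + y}) ->
  sconv op (f1 + f2) g = sconv op f1 g + sconv op f2 g.
Proof.
move=> opD; apply: seriesP => m Dm; rewrite scoefD !scoef_conv // -csumD.
by apply: eq_csum => i j _; rewrite scoefD opD.
Qed.

Lemma sconvDr (L M N : zmodType) (op : L -> M -> N) (f : series Delta L) g1 g2 :
    (forall x, {morph op x : y z / y + z}) ->
  sconv op f (g1 + g2) = sconv op f g1 + sconv op f g2.
Proof.
move=> opD; apply: seriesP => m Dm; rewrite scoefD !scoef_conv // -csumD.
by apply: eq_csum => i j _; rewrite scoefD opD.
Qed.

End SeriesConvolution.

Definition sconst (p : nat) (Delta : coideal p) (M : nmodType) (c : M) :
    series Delta M := fun u => if val u == 0%MM then c else 0.
Arguments sconst {p} Delta {M} c.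

Lemma scoef_const p (Delta : coideal p) (M : nmodType) (c : M) m :
  scoef (sconst Delta c) m = if m == 0%MM then c else 0.
Proof.
rewrite /scoef; case: insubP => [u _ uE|Dm]; first by rewrite /sconst uE.
by case: eqP => // m0; rewrite m0 coideal0 in Dm.
Qed.

(* The class of the monomial s^m; it is zero when [m] is not in [Delta]. *)
Definition smon (p : nat) (Delta : coideal p) (R : pzSemiRingType)
    (m : 'X_{1..p}) : series Delta R := fun u => (val u == m)%:R.
Arguments smon {p} Delta R m.

Definition svar (p : nat) (Delta : coideal p) (R : pzSemiRingType) (i : 'I_p) :
    series Delta R := smon Delta R U_(i)%MM.
Arguments svar {p} Delta R i.

Section SeriesRing.
Variables (p : nat) (Delta : coideal p) (R : pzRingType).
Implicit Types f g h : series Delta R.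

Definition smul f g : series Delta R := sconv *%R f g.

Fact smulA : associative smul.
Proof.
move=> f g h; rewrite /smul; symmetry; apply: sconvA.
- by move=> x y z; rewrite mulrA.
- by move=> z x y; apply: mulrDl.
- exact: mul0r.
- exact: mulrDr.
- exact: mulr0.
Qed.

Fact smul1l : left_id (sconst Delta 1) smul.
Proof.
move=> f; apply: seriesP => m Dm; rewrite scoef_conv // csum0l.
  by rewrite scoef_const eqxx mul1r.
by move=> i j _ /negbTE i0; rewrite scoef_const i0 mul0r.
Qed.

Fact smul1r : right_id (sconst Delta 1) smul.
Proof.
move=> f; apply: seriesP => m Dm; rewrite scoef_conv // csum0r.
  by rewrite scoef_const eqxx mulr1.
by move=> i j _ /negbTE j0; rewrite scoef_const j0 mulr0.
Qed.

Fact smulDl : left_distributive smul +%R.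
Proof. by move=> f g h; apply: sconvDl => z x y; apply: mulrDl. Qed.

Fact smulDr : right_distributive smul +%R.
Proof. by move=> f g h; apply: sconvDr; apply: mulrDr. Qed.

HB.instance Definition _ := GRing.Zmodule_isPzRing.Build (series Delta R)
  smulA smul1l smul1r smulDl smulDr.

Lemma scoefM f g m : Delta m ->
  scoef (f * g) m = csum m (fun i j => scoef f i * scoef g j).
Proof. exact: scoef_conv. Qed.

Lemma scoef1 m : scoef (1 : series Delta R) m = (m == 0%MM)%:R.
Proof. by rewrite scoef_const; case: eqP. Qed.

Lemma scoefM0 f g : scoef (f * g) 0%MM = scoef f 0%MM * scoef g 0%MM.
Proof.
rewrite scoefM ?coideal0 // csum0l // => i j /esym/eqP.
by rewrite mnmD_eq0 => /andP[/eqP->]; rewrite eqxx.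
Qed.

Lemma scoef_mon m' m : Delta m -> scoef (smon Delta R m') m = (m == m')%:R.
Proof. exact: (@scoef_mk _ _ _ (fun m => (m == m')%:R)). Qed.

Lemma smonD a b : smon Delta R a * smon Delta R b = smon Delta R (a + b)%MM.
Proof.
apply: seriesP => m Dm; rewrite scoefM // scoef_mon // (csum_delta (i := a) (j := b)).
  case: eqP => // mE; have [Da Db] := coidealD mE Dm.
  by rewrite !scoef_mon // !eqxx mulr1.
move=> i j mij ne; have [Di Dj] := coidealD mij Dm; rewrite !scoef_mon //.
by move: ne; rewrite xpair_eqE negb_and => /orP[]/negbTE->; rewrite ?(mulr0, mul0r).
Qed.

Lemma smon0 : smon Delta R 0%MM = 1.
Proof. by apply: seriesP => m Dm; rewrite scoef_mon // scoef1. Qed.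

Lemma smon_out m : ~~ Delta m -> smon Delta R m = 0.
Proof.
move=> Dm; apply: seriesP => m' Dm'; rewrite scoef_mon // scoef0.
by case: eqP => // E; rewrite -E Dm' in Dm.
Qed.

Lemma scoef_constM c f m : scoef (sconst Delta c * f) m = c * scoef f m.
Proof.
have [Dm|Dm] := boolP (Delta m); last by rewrite !scoef_out ?mulr0.
rewrite scoefM // csum0l ?scoef_const ?eqxx //.
by move=> i j _ /negbTE i0; rewrite scoef_const i0 mul0r.
Qed.

Lemma scoef_Mconst c f m : scoef (f * sconst Delta c) m = scoef f m * c.
Proof.
have [Dm|Dm] := boolP (Delta m); last by rewrite !scoef_out ?mul0r.
rewrite scoefM // csum0r ?scoef_const ?eqxx //.
by move=> i j _ /negbTE j0; rewrite scoef_const j0 mulr0.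
Qed.

Fact sconst_is_nmod_morphism : nmod_morphism (@sconst p Delta R).
Proof.
split=> [|c d]; apply: seriesP => m Dm; rewrite ?scoefD ?scoef0 !scoef_const.
  by case: eqP.
by case: eqP => // _; rewrite addr0.
Qed.

Fact sconst_is_monoid_morphism : monoid_morphism (@sconst p Delta R).
Proof.
split=> [//|c d]; apply: seriesP => m Dm.
by rewrite scoef_constM !scoef_const; case: eqP; rewrite ?mulr0.
Qed.

HB.instance Definition _ := GRing.isNmodMorphism.Build R (series Delta R)
  (@sconst p Delta R) sconst_is_nmod_morphism.
HB.instance Definition _ := GRing.isMonoidMorphism.Build R (series Delta R)
  (@sconst p Delta R) sconst_is_monoid_morphism.

End SeriesRing.

Section SeriesAlgebra.
Variables (p : nat) (Delta : coideal p) (A : comPzRingType).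

Fact sconst_central (c : A) (f : series Delta A) :
  sconst Delta c * f = f * sconst Delta c.
Proof. by apply: seriesP => m Dm; rewrite scoef_constM scoef_Mconst mulrC. Qed.

HB.instance Definition _ :=
  hasStructMap.Build A (series Delta A) sconst_central.

End SeriesAlgebra.

(* U^p(R; Delta) *)
Record useries (p : nat) (Delta : coideal p) (R : pzRingType) := USeries {
  useries_val :> series Delta R;
  useries_coef0 : scoef useries_val 0%MM = 1
}.

Section USeriesGroup.
Variables (p : nat) (Delta : coideal p) (R : pzRingType).
Implicit Types r s t : useries Delta R.

Lemma useriesP r s : r = s :> series Delta R -> r = s.
Proof.
case: r s => [r r0] [s s0] /= E; case: s / E s0 => s0.
by congr USeries; apply: Prop_irrelevance.
Qed.

HB.instance Definition _ := gen_eqMixin (useries Delta R).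
HB.instance Definition _ := gen_choiceMixin (useries Delta R).

Fact umul_coef0 r s : scoef (useries_val r * useries_val s) 0%MM = 1.
Proof. by rewrite scoefM0 !useries_coef0 mulr1. Qed.
Definition umul r s := USeries (umul_coef0 r s).

Fact uone_coef0 : scoef (1 : series Delta R) 0%MM = 1.
Proof. by rewrite scoef1 eqxx. Qed.
Definition uone := USeries uone_coef0.

Definition geom (f : series Delta R) N : series Delta R :=
  \sum_(n < N) (1 - f) ^+ n.

(* The inverse of [f] is the sum of the powers of [1 - f]; those of exponent
   greater than the degree of [m] do not contribute to the coefficient of s^m. *)
Definition sinv (f : series Delta R) : series Delta R :=
  fun u => scoef (geom f (mdeg (val u)).+1) (val u).

Lemma scoef_exp_small (f : series Delta R) n m :
  scoef f 0%MM = 0 -> (mdeg m < n)%N -> scoef (f ^+ n) m = 0.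
Proof.
move=> f0; elim: n m => [//|n IHn] m mn.
have [Dm|Dm] := boolP (Delta m); last by rewrite scoef_out.
rewrite exprS scoefM // csum0 // => i j mij.
have [-> | i0] := eqVneq i 0%MM; first by rewrite f0 mul0r.
rewrite IHn ?mulr0 //; move: mn; rewrite mij mdegD ltnS.
by apply: leq_trans; rewrite -addn1 addnC leq_add2r lt0n mdeg_eq0.
Qed.

Lemma scoef_geom r N N' m : (mdeg m < N)%N -> (mdeg m < N')%N ->
  scoef (geom r N) m = scoef (geom r N') m.
Proof.
have f0 : scoef (1 - useries_val r) 0%MM = 0.
  by rewrite scoefD scoefN scoef1 eqxx useries_coef0 subrr.
have E K : (mdeg m < K)%N -> scoef (geom r K) m = scoef (geom r (mdeg m).+1) m.
  move=> mK; rewrite /geom -(subnKC mK) big_split_ord /= scoefD.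
  rewrite [X in _ + X]scoef_sum [X in _ + X]big1 ?addr0 // => i _.
  by rewrite scoef_exp_small //= addSn ltnS leq_addr.
by move=> mN mN'; rewrite (E N) ?(E N').
Qed.

Lemma scoef_sinv r N m : (mdeg m < N)%N ->
  Delta m -> scoef (sinv r) m = scoef (geom r N) m.
Proof.
move=> mN Dm; rewrite (scoef_mk (fun m => scoef (geom r (mdeg m).+1) m)) //.
exact: scoef_geom.
Qed.

Lemma geomE (f : series Delta R) N :
  f * geom f N = 1 - (1 - f) ^+ N /\ geom f N * f = 1 - (1 - f) ^+ N.
Proof.
have fE : f = - (1 - f - 1) by rewrite addrC addKr opprK.
have fG : f * geom f N = 1 - (1 - f) ^+ N.
  by rewrite [X in X * _]fE mulNr -subrX1 opprB.
split=> //.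
have cf : GRing.comm f (geom f N).
  apply: commr_sum => i _; apply: commrX; apply: commrB; first exact: commr1.
  exact: commr_refl.
by rewrite -cf.
Qed.

Fact mulr_sinv r : useries_val r * sinv r = 1.
Proof.
apply: seriesP => m Dm; rewrite scoefM //.
transitivity (scoef (useries_val r * geom r (mdeg m).+1) m).
  rewrite scoefM //; apply: eq_csum => i j mij.
  rewrite (scoef_sinv r (N := (mdeg m).+1)) //; last exact: (coidealD mij Dm).2.
  by rewrite ltnS mij mdegD leq_addl.
rewrite (geomE _ _).1 scoefD scoefN scoef_exp_small ?subr0 //.
by rewrite scoefD scoefN scoef1 eqxx useries_coef0 subrr.
Qed.

Fact mul_sinvr r : sinv r * useries_val r = 1.
Proof.
apply: seriesP => m Dm; rewrite scoefM //.
transitivity (scoef (geom r (mdeg m).+1 * useries_val r) m).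
  rewrite scoefM //; apply: eq_csum => i j mij.
  rewrite (scoef_sinv r (N := (mdeg m).+1)) //; last exact: (coidealD mij Dm).1.
  by rewrite ltnS mij mdegD leq_addr.
rewrite (geomE _ _).2 scoefD scoefN scoef_exp_small ?subr0 //.
by rewrite scoefD scoefN scoef1 eqxx useries_coef0 subrr.
Qed.

Fact uinv_coef0 r : scoef (sinv r) 0%MM = 1.
Proof.
have := congr1 (fun f => scoef f 0%MM) (mulr_sinv r).
by rewrite scoefM0 useries_coef0 mul1r scoef1 eqxx.
Qed.
Definition uinv r := USeries (uinv_coef0 r).

Fact umulA : associative umul.
Proof. by move=> r s t; apply: useriesP; apply: mulrA. Qed.
Fact umul1l : left_id uone umul.
Proof. by move=> r; apply: useriesP; apply: mul1r. Qed.
Fact umul1r : right_id uone umul.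
Proof. by move=> r; apply: useriesP; apply: mulr1. Qed.
Fact umulVl : left_inverse uone uinv umul.
Proof. by move=> r; apply: useriesP; apply: mul_sinvr. Qed.
Fact umulVr : right_inverse uone uinv umul.
Proof. by move=> r; apply: useriesP; apply: mulr_sinv. Qed.

HB.instance Definition _ :=
  isGroup.Build (useries Delta R) umulA umul1l umul1r umulVl umulVr.

Lemma useriesM r s : (r * s)%g = useries_val r * useries_val s :> series Delta R.
Proof. by []. Qed.
Lemma useries1 : (1 : useries Delta R)%g = 1 :> series Delta R.
Proof. by []. Qed.
Lemma useriesVl r : useries_val r^-1%g * useries_val r = 1.
Proof. exact: mul_sinvr. Qed.
Lemma useriesVr r : useries_val r * useries_val r^-1%g = 1.
Proof. exact: mulr_sinv. Qed.

End USeriesGroup.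

(* End_k(A) *)
Record kend (k : comPzRingType) (A : comPzAlgType k) := KEnd {
  kend_fun :> A -> A;
  kendD : {morph kend_fun : x y / x + y};
  kendZ : forall (c : k) x, kend_fun (stmap c * x) = stmap c * kend_fun x
}.

Section KEndAlgebra.
Variables (k : comPzRingType) (A : comPzAlgType k).
Implicit Types f g h : kend A.

Lemma kendP f g : f =1 g -> f = g.
Proof.
case: f g => [f fD fZ] [g gD gZ] /= /funext E; case: g / E gD gZ => gD gZ.
by congr KEnd; apply: Prop_irrelevance.
Qed.

HB.instance Definition _ := gen_eqMixin (kend A).
HB.instance Definition _ := gen_choiceMixin (kend A).

Lemma kend0 f : f 0 = 0.
Proof. by apply: (@addIr _ (f 0)); rewrite -kendD !add0r. Qed.

Definition kend_zero : kend A.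
Proof.
by exists (fun=> 0) => [x y|c x]; rewrite ?addr0 ?mulr0.
Defined.

Definition kend_opp f : kend A.
Proof.
by exists (fun x => - f x) => [x y|c x]; rewrite ?kendD ?opprD ?kendZ ?mulrN.
Defined.

Definition kend_add f g : kend A.
Proof.
exists (fun x => f x + g x) => [x y|c x]; first by rewrite !kendD addrACA.
by rewrite !kendZ mulrDr.
Defined.

Definition kend_one : kend A.
Proof. by exists id. Defined.

Definition kend_comp f g : kend A.
Proof. by exists (f \o g) => [x y|c x] /=; rewrite ?kendD ?kendZ. Defined.

Definition kend_mul (a : A) : kend A.
Proof.
by exists ( *%R a) => [x y|c x]; rewrite ?mulrDr // mulrCA.
Defined.

Fact kend_addA : associative kend_add.
Proof. by move=> f g h; apply: kendP => x; apply: addrA. Qed.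
Fact kend_addC : commutative kend_add.
Proof. by move=> f g; apply: kendP => x; apply: addrC. Qed.
Fact kend_add0 : left_id kend_zero kend_add.
Proof. by move=> f; apply: kendP => x; apply: add0r. Qed.
Fact kend_addN : left_inverse kend_zero kend_opp kend_add.
Proof. by move=> f; apply: kendP => x; apply: addNr. Qed.

HB.instance Definition _ := GRing.isZmodule.Build (kend A)
  kend_addA kend_addC kend_add0 kend_addN.

Fact kend_compA : associative kend_comp.
Proof. by move=> f g h; apply: kendP. Qed.
Fact kend_comp1l : left_id kend_one kend_comp.
Proof. by move=> f; apply: kendP. Qed.
Fact kend_comp1r : right_id kend_one kend_comp.
Proof. by move=> f; apply: kendP. Qed.
Fact kend_compDl : left_distributive kend_comp +%R.
Proof. by move=> f g h; apply: kendP. Qed.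
Fact kend_compDr : right_distributive kend_comp +%R.
Proof. by move=> f g h; apply: kendP => x; apply: kendD. Qed.

HB.instance Definition _ := GRing.Zmodule_isPzRing.Build (kend A)
  kend_compA kend_comp1l kend_comp1r kend_compDl kend_compDr.

Lemma kendDE f g x : (f + g) x = f x + g x. Proof. by []. Qed.
Lemma kend0E x : (0 : kend A) x = 0. Proof. by []. Qed.
Lemma kendME f g x : (f * g) x = f (g x). Proof. by []. Qed.
Lemma kend1E x : (1 : kend A) x = x. Proof. by []. Qed.

Lemma kend_sumE (I : Type) (r : seq I) (P : pred I) (F : I -> kend A) x :
  (\sum_(i <- r | P i) F i) x = \sum_(i <- r | P i) F i x.
Proof. by elim/big_rec2: _ => // i y g _ <-. Qed.

Lemma kend_sum f (I : Type) (r : seq I) (P : pred I) (F : I -> A) :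
  f (\sum_(i <- r | P i) F i) = \sum_(i <- r | P i) f (F i).
Proof. exact: (big_morph f (kendD f) (kend0 f)). Qed.

Lemma kendMnE f n x : (f *+ n) x = f x *+ n.
Proof. by elim: n => // n IHn; rewrite !mulrS kendDE IHn. Qed.

Fact kend_mul_is_nmod_morphism : nmod_morphism kend_mul.
Proof.
by split=> [|a b]; apply: kendP => x /=; rewrite ?mul0r ?kendDE /= ?mulrDl.
Qed.

Fact kend_mul_is_monoid_morphism : monoid_morphism kend_mul.
Proof.
by split=> [|a b]; apply: kendP => x /=; rewrite ?mul1r ?kendME /= ?mulrA.
Qed.

HB.instance Definition _ := GRing.isNmodMorphism.Build A (kend A) kend_mul
  kend_mul_is_nmod_morphism.
HB.instance Definition _ := GRing.isMonoidMorphism.Build A (kend A) kend_mul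
  kend_mul_is_monoid_morphism.

Definition kend_stmap : k -> kend A := kend_mul \o stmap.
HB.instance Definition _ := GRing.RMorphism.on kend_stmap.

Fact kend_stmap_central (c : k) f : kend_stmap c * f = f * kend_stmap c.
Proof. by apply: kendP => x; rewrite !kendME /= kendZ. Qed.

HB.instance Definition _ := hasStructMap.Build k (kend A) kend_stmap_central.

Fact kend_mul_stmap (c : k) : kend_mul (stmap c) = stmap c.
Proof. by []. Qed.

HB.instance Definition _ :=
  isStructMapMorphism.Build k A (kend A) kend_mul kend_mul_stmap.

End KEndAlgebra.

Definition hs_leibniz (p : nat) (Delta : coideal p) (k : comPzRingType)
    (A : comPzAlgType k) (D : series Delta (kend A)) : Prop :=
  forall m, Delta m -> forall x y : A,
    scoef D m (x * y) = csum m (fun i j => scoef D i x * scoef D j y).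

(* HS^p_k(A; Delta) *)
Record hasse_schmidt (p : nat) (Delta : coideal p) (k : comPzRingType)
    (A : comPzAlgType k) := HasseSchmidt {
  hs_val :> useries Delta (kend A);
  hsP : hs_leibniz hs_val
}.

Section HasseSchmidtGroup.
Variables (p : nat) (Delta : coideal p) (k : comPzRingType) (A : comPzAlgType k).
Implicit Types (F G : series Delta (kend A)) (f g : series Delta A).

(* Action of End_k(A)[[s]]_Delta on A[[s]]_Delta. *)
Definition sact F f : series Delta A := sconv (fun (h : kend A) x => h x) F f.

Lemma sactM F G f : sact (F * G) f = sact F (sact G f).
Proof.
apply: sconvA => //; [exact: kendD | exact: kend0].
Qed.

Lemma scoef_sact_const F x m :
  scoef (sact F (sconst Delta x)) m = scoef F m x.
Proof.
have [Dm|Dm] := boolP (Delta m); last by rewrite !scoef_out.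
rewrite scoef_conv // csum0r ?scoef_const ?eqxx //.
by move=> i j _ /negbTE j0; rewrite scoef_const j0 kend0.
Qed.

Lemma sact1 f : sact 1 f = f.
Proof.
apply: seriesP => m Dm; rewrite scoef_conv // csum0l ?scoef1 ?eqxx //.
by move=> i j _ /negbTE i0; rewrite scoef1 i0.
Qed.

Lemma hs_leibnizP F :
  hs_leibniz F <-> forall f g, sact F (f * g) = sact F f * sact F g.
Proof.
split=> [FL f g|FM m Dm x y]; last first.
  rewrite -scoef_sact_const rmorphM FM scoefM //.
  by apply: eq_csum => i j _; rewrite !scoef_sact_const.
apply: seriesP => m Dm; rewrite scoef_conv // scoefM //.
transitivity (csum m (fun i j => csum i (fun a b => csum j (fun c d =>
    scoef F a (scoef f c) * scoef F b (scoef g d))))).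
  apply: eq_csum => i j mij; have [Di Dj] := coidealD mij Dm.
  rewrite scoefM // /csum kend_sum exchange_big /=.
  by apply: eq_bigr => cd _; apply: FL.
rewrite csumACA; apply: eq_csum => i j mij; have [Di Dj] := coidealD mij Dm.
rewrite !scoef_conv // /csum mulr_suml; apply: eq_bigr => ac _.
by rewrite mulr_sumr.
Qed.

Lemma hasse_schmidtP (D E : hasse_schmidt Delta A) :
  D = E :> useries Delta (kend A) -> D = E.
Proof.
case: D E => [D DL] [E EL] /= DE; case: E / DE EL => EL.
by congr HasseSchmidt; apply: Prop_irrelevance.
Qed.

HB.instance Definition _ := gen_eqMixin (hasse_schmidt Delta A).
HB.instance Definition _ := gen_choiceMixin (hasse_schmidt Delta A).

Implicit Types D E : hasse_schmidt Delta A.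

Fact hs_one_leibniz : hs_leibniz (1 : useries Delta (kend A))%g.
Proof. by apply/hs_leibnizP => f g; rewrite !sact1. Qed.
Definition hs_one := HasseSchmidt hs_one_leibniz.

Fact hs_mul_leibniz D E : hs_leibniz (hs_val D * hs_val E)%g.
Proof.
have /hs_leibnizP DM := hsP D; have /hs_leibnizP EM := hsP E.
by apply/hs_leibnizP => f g; rewrite useriesM !sactM EM DM.
Qed.
Definition hs_mul D E := HasseSchmidt (hs_mul_leibniz D E).

Fact hs_inv_leibniz D : hs_leibniz (hs_val D)^-1%g.
Proof.
have /hs_leibnizP DM := hsP D; apply/hs_leibnizP => f g.
have DV h : sact D (sact (useries_val (hs_val D)^-1%g) h) = h.
  by rewrite -sactM useriesVr sact1.
have VD h : sact (useries_val (hs_val D)^-1%g) (sact D h) = h.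
  by rewrite -sactM useriesVl sact1.
by rewrite -{1}[f]DV -{1}[g]DV -DM VD.
Qed.
Definition hs_inv D := HasseSchmidt (hs_inv_leibniz D).

Fact hs_mulA : associative hs_mul.
Proof. by move=> *; apply: hasse_schmidtP; apply: umulA. Qed.
Fact hs_mul1l : left_id hs_one hs_mul.
Proof. by move=> *; apply: hasse_schmidtP; apply: umul1l. Qed.
Fact hs_mul1r : right_id hs_one hs_mul.
Proof. by move=> *; apply: hasse_schmidtP; apply: umul1r. Qed.
Fact hs_mulVl : left_inverse hs_one hs_inv hs_mul.
Proof. by move=> *; apply: hasse_schmidtP; apply: umulVl. Qed.
Fact hs_mulVr : right_inverse hs_one hs_inv hs_mul.
Proof. by move=> *; apply: hasse_schmidtP; apply: umulVr. Qed.

HB.instance Definition _ := isGroup.Build (hasse_schmidt Delta A)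
  hs_mulA hs_mul1l hs_mul1r hs_mulVl hs_mulVr.

End HasseSchmidtGroup.

Record substmap (A : comPzRingType) (p : nat) (Delta : coideal p)
    (q : nat) (Omega : coideal q) := SubstMap {
  subst_mor :> {algmorphism series Delta A -> series Omega A};
  subst_coef0 : forall i : 'I_p, scoef (subst_mor (svar Delta A i)) 0%MM = 0
}.

(* The coefficient of t^e in the (possibly infinite) sum of the phi(s^a) r_a;
   the terms with |a| > |e| do not contribute, see [subst_small]. *)
Definition bullet (A : comPzRingType) (R : pzRingType) (iota : {rmorphism A -> R})
    (p : nat) (Delta : coideal p) (q : nat) (Omega : coideal q)
    (phi : substmap A Delta Omega) (r : series Delta R) : series Omega R :=
  fun e => \sum_(a : 'X_{1..p < (mdeg (val e)).+1})
             iota (scoef (phi (smon Delta A a)) (val e)) * scoef r a.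

Section Substitution.
Variables (A : comPzRingType) (R : pzRingType) (iota : {rmorphism A -> R}).
Variables (p : nat) (Delta : coideal p) (q : nat) (Omega : coideal q).
Variable phi : substmap A Delta Omega.

Lemma subst_small a e :
  (mdeg e < mdeg a)%N -> scoef (phi (smon Delta A a)) e = 0.
Proof.
move: {2}(mdeg a) (erefl (mdeg a)) => n; elim: n a e => [|n IHn] a e an.
  by rewrite an.
rewrite an => en; have [De|De] := boolP (Omega e); last by rewrite scoef_out.
have /existsP[i ai] : [exists i, a i != 0%N].
  apply: contraT; rewrite negb_exists => /forallP a0.
  suff a0' : a = 0%MM by rewrite a0' mdeg0 in an.
  by apply/mnmP => i; rewrite mnm0E; apply/eqP; have := a0 i; rewrite negbK.
have le : (U_(i) <= a)%MM by rewrite lep1mP.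
have mb : mdeg (a - U_(i))%MM = n.
  by have := congr1 (@mdeg p) (submK le); rewrite mdegD mdeg1 an addn1 => -[].
rewrite -(submK le) addmC -smonD rmorphM scoefM // csum0 // => u v euv.
have [-> | u0] := eqVneq u 0%MM; first by rewrite subst_coef0 mul0r.
rewrite [X in _ * X]IHn ?mulr0 // mb -ltnS; apply: leq_trans en.
by rewrite ltnS euv mdegD -add1n leq_add2r lt0n mdeg_eq0.
Qed.

Lemma scoef_bullet (r : series Delta R) N e : (mdeg e < N)%N -> Omega e ->
  scoef (bullet iota phi r) e =
  \sum_(a : 'X_{1..p < N}) iota (scoef (phi (smon Delta A a)) e) * scoef r a.
Proof.
move=> eN Oe; rewrite (scoef_mk (fun e => \sum_(a : 'X_{1..p < (mdeg e).+1})
  iota (scoef (phi (smon Delta A a)) e) * scoef r a)) //.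
pose G (a : 'X_{1..p}) := iota (scoef (phi (smon Delta A a)) e) * scoef r a.
have cond K : (mdeg e < K)%N -> \sum_(a : 'X_{1..p < K}) G a =
    \sum_(a : 'X_{1..p < K} | (mdeg a <= mdeg e)%N) G a.
  move=> eK; rewrite [RHS]big_mkcond; apply: eq_bigr => a _.
  case: leqP => // ea; by rewrite /G subst_small // rmorph0 mul0r.
rewrite -/(G _) (cond _ (leqnn _)) (cond _ eN).
by apply: (big_bound (P := fun a => (mdeg a <= mdeg e)%N)) => a // /leq_ltn_trans; apply.
Qed.

Fact bullet_coef0 (r : useries Delta R) : scoef (bullet iota phi r) 0%MM = 1.
Proof.
rewrite (@scoef_bullet _ 1) ?mdeg0 ?coideal0 //.
rewrite (big_pred1 (bm0 : 'X_{1..p < 1})) => [|a].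
  by rewrite smon0 rmorph1 scoef1 eqxx rmorph1 mul1r useries_coef0.
by rewrite -[RHS]/(a == _) bmeqP /= -mdeg_eq0; have := bmdeg a; rewrite ltnS leqn0 => ->.
Qed.

Definition ubullet (r : useries Delta R) : useries Omega R :=
  USeries (bullet_coef0 r).

End Substitution.

Section HasseSchmidtSubstitution.
Variables (k : comPzRingType) (A : comPzAlgType k).
Variables (p : nat) (Delta : coideal p) (q : nat) (Omega : coideal q).
Variable phi : substmap A Delta Omega.

Fact hsbullet_leibniz (D : hasse_schmidt Delta A) :
  hs_leibniz (ubullet (kend_mul (A := A)) phi D).
Proof.
move=> e Oe x y; rewrite /=.
set N := (mdeg e).+1; pose P a e := scoef (phi (smon Delta A a)) e.
have bE (e' : 'X_{1..q}) z : (mdeg e' < N)%N -> Omega e' ->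
    scoef (bullet (kend_mul (A := A)) phi D) e' z =
    \sum_(a : 'X_{1..p < N}) P a e' * scoef D a z.
  by move=> e'N Oe'; rewrite (scoef_bullet _ _ _ e'N Oe') kend_sumE.
rewrite bE //.
transitivity (\sum_(b : 'X_{1..p < N}) \sum_(c : 'X_{1..p < N})
    P (b + c)%MM e * (scoef D b x * scoef D c y)); last first.
  transitivity (csum e (fun u v => \sum_(b : 'X_{1..p < N})
      \sum_(c : 'X_{1..p < N})
        (P b u * P c v) * (scoef D b x * scoef D c y))).
    rewrite csum_sum; apply: eq_bigr => b _.
    rewrite csum_sum; apply: eq_bigr => c _.
    rewrite /P -smonD rmorphM scoefM // /csum mulr_suml.
    by apply: eq_bigr.
  apply: eq_csum => u v euv; have [Ou Ov] := coidealD euv Oe.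
  rewrite !bE // ?ltnS ?euv ?mdegD ?leq_addl ?leq_addr //.
  rewrite mulr_suml; apply: eq_bigr => b _.
  by rewrite mulr_sumr; apply: eq_bigr => c _; rewrite mulrACA.
transitivity (\sum_(a : 'X_{1..p < N}) \sum_(b : 'X_{1..p < N})
   \sum_(c : 'X_{1..p < N} | val a == (b + c)%MM)
     P a e * (scoef D b x * scoef D c y)).
  apply: eq_bigr => a _; have [Da|Da] := boolP (Delta a); last first.
    rewrite /P smon_out // rmorph0 scoef0 mul0r big1 // => b _.
    by rewrite big1 // => c _; rewrite mul0r.
  rewrite hsP // (csumE _ (bmdeg a)) mulr_sumr.
  by apply: eq_bigr => b _; rewrite mulr_sumr.
rewrite exchange_big /=; apply: eq_bigr => b _.
rewrite (exchange_big_dep predT) //=; apply: eq_bigr => c _.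
have [bcN|bcN] := boolP (mdeg (b + c)%MM < N)%N.
  by rewrite (big_pred1 (BMultinom bcN)) // => a; rewrite -[RHS]/(a == _) bmeqP.
rewrite /P subst_small ?mul0r; last by rewrite -leqNgt in bcN.
rewrite big_pred0 // => a; apply/negbTE; apply: contra bcN => /eqP <-.
exact: bmdeg.
Qed.

Definition hsbullet (D : hasse_schmidt Delta A) : hasse_schmidt Omega A :=
  HasseSchmidt (hsbullet_leibniz D).

End HasseSchmidtSubstitution.

Record hs_structure (k : comPzRingType) (A : comPzAlgType k) (R : pzAlgType k)
    (iota : {algmorphism A -> R}) := HSStructure {
  hs_Psi :> forall (p : nat) (Delta : coideal p),
    hasse_schmidt Delta A -> useries Delta R;
  hs_PsiM : forall p (Delta : coideal p),
    {morph @hs_Psi p Delta : D E / (D * E)%g};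
  hs_Psi_const : forall p (Delta : coideal p) (D : hasse_schmidt Delta A) (a : A),
    useries_val (hs_Psi D) * sconst Delta (iota a) =
    smap (fun h : kend A => iota (h a)) D * useries_val (hs_Psi D);
  hs_Psi_bullet : forall p (Delta : coideal p) q (Omega : coideal q)
      (phi : substmap A Delta Omega) (D : hasse_schmidt Delta A),
    hs_Psi (hsbullet phi D) = ubullet iota phi (hs_Psi D)
}.

Definition chi (p : nat) (Delta : coideal p) (M : nmodType)
    (f : series Delta M) : series Delta M := fun u => f u *+ mdeg (val u).

Definition eps (p : nat) (Delta : coideal p) (R : pzRingType)
    (r : useries Delta R) : series Delta R := useries_val r^-1%g * chi r.

(* Der_k(A) *)
Record kder (k : comPzRingType) (A : comPzAlgType k) := KDer {
  kder_end :> kend A;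
  kderM : forall x y, kder_end (x * y) = kder_end x * y + x * kder_end y
}.

Section Epsilon.
Variables (p : nat) (Delta : coideal p).

Lemma scoef_chi (M : nmodType) (f : series Delta M) m :
  scoef (chi f) m = scoef f m *+ mdeg m.
Proof.
rewrite /scoef; case: insubP => [u _ uE|]; last by rewrite mul0rn.
by rewrite /chi uE.
Qed.

Lemma eps_coef0 (R : pzRingType) (r : useries Delta R) : scoef (eps r) 0%MM = 0.
Proof. by rewrite scoefM0 scoef_chi mdeg0 mulr0n mulr0. Qed.

Variables (k : comPzRingType) (A : comPzAlgType k).

Fact eps_der (D : hasse_schmidt Delta A) u x y :
  eps D u (x * y) = eps D u x * y + x * eps D u y.
Proof.
have /hs_leibnizP VM := hs_inv_leibniz D.
have chiM : sact (chi D) (sconst Delta (x * y)) =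
    sact (chi D) (sconst Delta x) * sact D (sconst Delta y) +
    sact D (sconst Delta x) * sact (chi D) (sconst Delta y).
  apply: seriesP => m Dm; rewrite scoef_sact_const scoefD !scoefM // -csumD.
  rewrite scoef_chi kendMnE hsP // /csum -sumrMnl.
  apply: eq_bigr => ij /eqP mij; rewrite !scoef_sact_const !scoef_chi !kendMnE.
  by rewrite mulrnAl mulrnAr -mulrnDr -mdegD -mij.
have sactDr (F : series Delta (kend A)) f g : sact F (f + g) = sact F f + sact F g.
  by apply: sconvDr; apply: kendD.
have := congr1 (sact (useries_val (hs_val D)^-1%g)) chiM.
rewrite sactDr !VM -!sactM -/(eps D) useriesVl !sact1.
move/(congr1 (fun f => scoef f (val u))).
by rewrite scoefD scoef_Mconst scoef_constM !scoef_sact_const !scoef_val.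
Qed.

(* [eps D], as an element of Der_k(A)[[s]]_Delta. *)
Definition hs_eps (D : hasse_schmidt Delta A) : series Delta (kder A) :=
  fun u => KDer (eps_der D u).

End Epsilon.

Fact ci01_nonempty : exists m : 'X_{1..1}, (mdeg m <= 1)%N.
Proof. by exists 0%MM; rewrite mdeg0. Qed.

Fact ci01_down (m m' : 'X_{1..1}) :
  (m' <= m)%MM -> (mdeg m <= 1)%N -> (mdeg m' <= 1)%N.
Proof. by move=> mm'; apply: leq_trans; rewrite -(submK mm') mdegD leq_addl. Qed.

(* The co-ideal {0, 1} of N. *)
Definition ci01 : coideal 1 :=
  @Coideal 1 (fun m => (mdeg m <= 1)%N) ci01_nonempty ci01_down.

Lemma useries_ci01E (R : pzRingType) (r : useries ci01 R) :
  useries_val r =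
  1 + sconst ci01 (scoef r U_(ord0)%MM) * svar ci01 R ord0.
Proof.
apply: seriesP => m Dm; rewrite scoefD scoef1 scoef_constM scoef_mon //.
have [->|m0] := eqVneq m 0%MM.
  by rewrite useries_coef0 eq_sym mnm1_eq0 mulr0 addr0.
have /mdeg1P[i /eqP->] : mdeg m == 1%N.
  by rewrite eqn_leq [(_ <= 1)%N]Dm lt0n mdeg_eq0.
by rewrite [i]ord1 eqxx mulr1 add0r.
Qed.

Section DerivationHasseSchmidt.
Variables (k : comPzRingType) (A : comPzAlgType k) (delta : kder A).

Definition hs_of_der_series : series ci01 (kend A) :=
  1 + sconst ci01 (delta : kend A) * svar ci01 (kend A) ord0.

Fact hs_of_der_coef0 : scoef hs_of_der_series 0%MM = 1.
Proof.
rewrite scoefD scoef1 eqxx scoef_constM scoef_mon ?coideal0 //.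
by rewrite eq_sym mnm1_eq0 mulr0 addr0.
Qed.

Fact hs_of_der_leibniz : hs_leibniz (USeries hs_of_der_coef0).
Proof.
have hE (m : 'X_{1..1}) z : (mdeg m <= 1)%N -> scoef hs_of_der_series m z =
    (if m == 0%MM then z else 0) + (if m == U_(ord0)%MM then delta z else 0).
  move=> Dm; rewrite scoefD scoef1 scoef_constM scoef_mon // kendDE kendME.
  by case: eqP => _; case: eqP => _ //=; rewrite kend0.
move=> m Dm x y; rewrite /= hE //.
have [m0|m0] := eqVneq m 0%MM.
  rewrite csum0l => [|i j]; last first.
    by rewrite m0 => /esym/eqP; rewrite mnmD_eq0 => /andP[->].
  rewrite m0 !hE ?mdeg0 // eqxx [_ == U_(_)%MM]eq_sym mnm1_eq0 !addr0 //.
have m1 : m = U_(ord0)%MM.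
  have /mdeg1P[i /eqP->] : mdeg m == 1%N.
    by rewrite eqn_leq [(_ <= 1)%N]Dm lt0n mdeg_eq0.
  by rewrite [i]ord1.
rewrite m1 eqxx add0r kderM.
have split01 (i j : 'X_{1..1}) : U_(ord0)%MM = (i + j)%MM ->
    (i, j) = (U_(ord0)%MM, 0%MM) \/ (i, j) = (0%MM, U_(ord0)%MM).
  move=> ij; have [i0|i0] := eqVneq i 0%MM.
    by right; rewrite ij i0 add0m.
  left; have : mdeg (i + j)%MM = 1%N by rewrite -ij mdeg1.
  rewrite mdegD => dij.
  have j0 : j = 0%MM.
    apply/eqP; move: i0 dij; rewrite -!mdeg_eq0.
    by case: (mdeg i) (mdeg j) => [|[|?]] [|?].
  by rewrite ij j0 addm0.
set G := fun i j => _.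
have -> : G = fun i j => (if i == 0%MM then G i j else 0) +
                         (if i == 0%MM then 0 else G i j).
  by apply: funext => i; apply: funext => j; case: eqP; rewrite ?addr0 ?add0r.
have u0 : (U_(ord0) == 0 :> 'X_{1..1})%MM = false by rewrite mnm1_eq0.
have u0' : (0 == U_(ord0) :> 'X_{1..1})%MM = false by rewrite eq_sym mnm1_eq0.
rewrite csumD addrC; congr (_ + _).
  rewrite (csum_delta (i := U_(ord0)%MM) (j := 0%MM)) => [|a b /split01[][-> ->]].
  - by rewrite addm0 !eqxx u0 /G !hE ?mdeg0 ?mdeg1 // !eqxx u0 u0' addr0 add0r.
  - by rewrite eqxx.
  - by rewrite eqxx.
rewrite (csum_delta (i := 0%MM) (j := U_(ord0)%MM)) => [|a b /split01[][-> ->]].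
- by rewrite add0m !eqxx /G !hE ?mdeg0 ?mdeg1 // !eqxx u0 u0' addr0 add0r.
- by rewrite u0.
- by rewrite eqxx.
Qed.

(* Id + delta s *)
Definition hs_of_der : hasse_schmidt ci01 A := HasseSchmidt hs_of_der_leibniz.

End DerivationHasseSchmidt.

(* Main.v *)
(* Adjoin a variable t with t^2 = 0.  The substitution s_i |-> s_i (1 + t) sends
   a series r to r + chi(r) t = r (1 + eps(r) t).  Once degrees are bounded, the
   Hasse-Schmidt derivation 1 + eps(D) t is a finite product of factors
   1 + delta_a s^a t, each obtained from Id + delta_a s by substituting s^a t
   for s.  Psi commutes with substitutions and products, so it sends
   1 + eps(D) t to 1 + nabla(eps(D)) t; comparing the coefficients of t in the
   image of D + chi(D) t under Psi gives chi(Psi(D)) = Psi(D) nabla(eps(D)). *)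
Require Import Defs.
From HB Require Import structures.
From mathcomp Require Import all_boot all_order all_algebra.
From mathcomp Require Import mpoly.

Local Open Scope ring_scope.

Set Implicit Arguments.
Unset Strict Implicit.
Unset Printing Implicit Defensive.
Import GRing.Theory.

Lemma scoefMn (p : nat) (Delta : coideal p) (M : zmodType)
    (f : series Delta M) n m : scoef (f *+ n) m = scoef f m *+ n.
Proof. by elim: n => [|n IHn]; rewrite ?scoef0 // !mulrS scoefD IHn. Qed.

Lemma scoef_smap (p : nat) (Delta : coideal p) (M N : nmodType)
    (h : {additive M -> N}) (f : series Delta M) m :
  scoef (smap h f) m = h (scoef f m).
Proof. by rewrite /scoef; case: insub => //; rewrite raddf0. Qed.

(** * Sums of the series P_a f_a, for a family P indexed by exponents *)

Section WeightedSum.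
Variables (p : nat) (Delta : coideal p) (q : nat) (Omega : coideal q).
Variable R : pzRingType.
Implicit Types (P Q S : 'X_{1..p} -> series Omega R) (f g : series Delta R).

(** The a priori infinite sum of the P_a f_a, cut off at |a| <= |e| in the coefficient of e. Under
    [order_ge P] the discarded terms vanish, so any larger bound gives the same value
    ([scoef_wsum]). *)
Definition wsum P f : series Omega R := fun e =>
  \sum_(a : 'X_{1..p < (mdeg (val e)).+1}) scoef (P a) (val e) * scoef f a.

Definition order_ge P :=
  forall a e, (mdeg e < mdeg a)%N -> scoef (P a) e = 0.

Lemma scoef_wsum P f N e : order_ge P -> (mdeg e < N)%N -> Omega e ->
  scoef (wsum P f) e =
  \sum_(a : 'X_{1..p < N}) scoef (P a) e * scoef f a.
Proof.
move=> Psmall eN Oe.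
rewrite (scoef_mk (fun e => \sum_(a : 'X_{1..p < (mdeg e).+1})
  scoef (P a) e * scoef f a)) //.
pose G (a : 'X_{1..p}) := scoef (P a) e * scoef f a.
have cond K : (mdeg e < K)%N -> \sum_(a : 'X_{1..p < K}) G a =
    \sum_(a : 'X_{1..p < K} | (mdeg a <= mdeg e)%N) G a.
  move=> eK; rewrite [RHS]big_mkcond; apply: eq_bigr => a _.
  by case: leqP => // ea; rewrite /G Psmall // mul0r.
rewrite -/(G _) (cond _ (leqnn _)) (cond _ eN).
by apply: (big_bound (P := fun a => (mdeg a <= mdeg e)%N)) => a // /leq_ltn_trans; apply.
Qed.

Lemma wsumDr P f g : wsum P (f + g) = wsum P f + wsum P g.
Proof.
apply: boolp.funext => e; rewrite /wsum -[RHS]/(_ + _) -big_split.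
by apply: eq_bigr => a _; rewrite scoefD mulrDr.
Qed.

Lemma wsum0r P : wsum P 0 = 0.
Proof. by apply: (@addrI _ (wsum P 0)); rewrite -wsumDr !addr0. Qed.

Lemma wsumDl P Q f :
  wsum (fun a => P a + Q a) f = wsum P f + wsum Q f.
Proof.
apply: boolp.funext => e; rewrite /wsum -[RHS]/(_ + _) -big_split.
by apply: eq_bigr => a _; rewrite scoefD mulrDl.
Qed.

Lemma wsum_chi P f : wsum (fun a => P a *+ mdeg a) f = wsum P (chi f).
Proof.
apply: boolp.funext => e; apply: eq_bigr => a _; 
by rewrite scoef_chi scoefMn mulrnAl mulrnAr.
Qed.

Lemma wsum_mon P c a : order_ge P -> (~~ Delta a -> P a = 0) ->
  wsum P (sconst Delta c * smon Delta R a) = P a * sconst Omega c.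
Proof.
move=> Psmall Pout; have [Da|nDa] := boolP (Delta a); last first.
  by rewrite smon_out // Pout // mulr0 wsum0r mul0r.
apply: seriesP => e Oe; rewrite scoef_Mconst.
(* The bound is raised so that the index [a] itself occurs in the sum, even when |a| > |e|. *)
rewrite (scoef_wsum _ (N := (maxn (mdeg e) (mdeg a)).+1)) ?ltnS ?leq_maxl //.
have aN : (mdeg a < (maxn (mdeg e) (mdeg a)).+1)%N by rewrite ltnS leq_maxr.
rewrite (bigD1 (BMultinom aN)) //= scoef_constM scoef_mon // eqxx mulr1.
rewrite big1 ?addr0 // => b bNa.
have ba : (val b == a) = false.
  by apply/negbTE; apply: contra bNa => /eqP ba; apply/eqP/val_inj.
rewrite scoef_constM; have [Db|Db] := boolP (Delta (val b)).
  by rewrite scoef_mon // ba !mulr0.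
by rewrite [X in c * X]scoef_out // !mulr0.
Qed.

(** Both sides are the sum of the S_(b+c) f_b g_c. Three distinct families are allowed so that the
    lemma covers ring morphisms as well as products of the form (f t^i)(g t^j). *)
Lemma wsumM P Q S f g : order_ge P -> order_ge Q -> order_ge S ->
    (forall a b, P a * Q b = S (a + b)%MM) ->
    (forall a, ~~ Delta a -> S a = 0) ->
    (forall b e x, GRing.comm x (scoef (Q b) e)) ->
  wsum P f * wsum Q g = wsum S (f * g).
Proof.
move=> Psmall Qsmall Ssmall PQ Sout Qcomm; apply: seriesP => e Oe.
set N := (mdeg e).+1; rewrite scoefM // (scoef_wsum _ (N := N)) //.
transitivity (\sum_(b : 'X_{1..p < N}) \sum_(c : 'X_{1..p < N})
    scoef (S (b + c)%MM) e * (scoef f b * scoef g c)).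
  transitivity (csum e (fun u v => \sum_(b : 'X_{1..p < N})
      \sum_(c : 'X_{1..p < N})
        (scoef (P b) u * scoef (Q c) v) * (scoef f b * scoef g c))).
    apply: eq_csum => u v euv; have [Ou Ov] := coidealD euv Oe.
    rewrite !(scoef_wsum _ (N := N)) // ?ltnS ?euv ?mdegD ?leq_addl ?leq_addr //.
    rewrite mulr_suml; apply: eq_bigr => b _.
    rewrite mulr_sumr; apply: eq_bigr => c _.
    (* The only commutation needed: the coefficient of Q_c moves past f_b. *)
    by rewrite -!mulrA; congr (_ * _); rewrite !mulrA Qcomm.
  rewrite csum_sum; apply: eq_bigr => b _.
  rewrite csum_sum; apply: eq_bigr => c _.
  by rewrite -PQ scoefM // /csum mulr_suml.
transitivity (\sum_(a : 'X_{1..p < N}) \sum_(b : 'X_{1..p < N})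
   \sum_(c : 'X_{1..p < N} | val a == (b + c)%MM)
     scoef (S a) e * (scoef f b * scoef g c)); last first.
  apply: eq_bigr => a _; have [Da|Da] := boolP (Delta a); last first.
    rewrite Sout // scoef0 mul0r big1 // => b _.
    by rewrite big1 // => c _; rewrite mul0r.
  rewrite scoefM // (csumE _ (bmdeg a)) mulr_sumr.
  by apply: eq_bigr => b _; rewrite mulr_sumr.
rewrite [RHS]exchange_big /=; apply: eq_bigr => b _.
rewrite [RHS](exchange_big_dep predT) //=; apply: eq_bigr => c _.
have [bcN|bcN] := boolP (mdeg (b + c)%MM < N)%N.
  by rewrite (big_pred1 (BMultinom bcN)) // => a; rewrite -[RHS]/(a == _) bmeqP.
(* When |b + c| > |e|, the term on the left is zero by the order condition and no index [a] on the
   right equals b + c. *)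
rewrite Ssmall ?mul0r; last by rewrite -leqNgt in bcN.
rewrite big_pred0 // => a; apply/negbTE; apply: contra bcN => /eqP <-.
exact: bmdeg.
Qed.

End WeightedSum.

(** * Substitution maps built from the images of monomials *)

Record power_family (A : pzRingType) (p : nat) (Delta : coideal p)
    (q : nat) (Omega : coideal q) := PowerFamily {
  pow_fun :> 'X_{1..p} -> series Omega A;
  pow0 : pow_fun 0%MM = 1;
  powD : forall a b, pow_fun a * pow_fun b = pow_fun (a + b)%MM;
  pow_out : forall a, ~~ Delta a -> pow_fun a = 0;
  pow_order : order_ge pow_fun
}.

(** A power family P yields the substitution map sending s^a to P_a: [pow_out] makes it well defined
    modulo Delta, and [pow_order] ensures both convergence and zero constant terms for the images of
    the variables. *)
Section SubstitutionOfPowers.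
Variables (A : comPzRingType) (p : nat) (Delta : coideal p).
Variables (q : nat) (Omega : coideal q) (P : power_family A Delta Omega).

Definition pow_subst_fun : series Delta A -> series Omega A := wsum P.

Fact pow_subst_const (c : A) :
  pow_subst_fun (sconst Delta c) = sconst Omega c.
Proof.
have := wsum_mon c (a := 0%MM) (@pow_order _ _ _ _ _ P) (@pow_out _ _ _ _ _ P _).
by rewrite smon0 mulr1 pow0 mul1r.
Qed.

Fact pow_subst_is_nmod_morphism : nmod_morphism pow_subst_fun.
Proof. by split; [apply: wsum0r | apply: wsumDr]. Qed.

Fact pow_subst_is_monoid_morphism : monoid_morphism pow_subst_fun.
Proof.
split; first exact: pow_subst_const.
move=> f g; apply/esym/wsumM; try exact: pow_order.
- exact: powD.
- exact: pow_out.
- by move=> b e x; apply: mulrC.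
Qed.

HB.instance Definition _ := GRing.isNmodMorphism.Build (series Delta A)
  (series Omega A) pow_subst_fun pow_subst_is_nmod_morphism.
HB.instance Definition _ := GRing.isMonoidMorphism.Build (series Delta A)
  (series Omega A) pow_subst_fun pow_subst_is_monoid_morphism.
HB.instance Definition _ := isStructMapMorphism.Build A (series Delta A)
  (series Omega A) pow_subst_fun pow_subst_const.

Lemma pow_subst_mon a : pow_subst_fun (smon Delta A a) = P a.
Proof.
have := wsum_mon 1 (a := a) (@pow_order _ _ _ _ _ P) (@pow_out _ _ _ _ _ P a).
by rewrite rmorph1 mul1r mulr1.
Qed.

Fact pow_subst_coef0 (i : 'I_p) :
  scoef (pow_subst_fun (svar Delta A i)) 0%MM = 0.
Proof. by rewrite pow_subst_mon pow_order // mdeg0 mdeg1. Qed.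

Definition pow_subst : substmap A Delta Omega :=
  @SubstMap _ _ _ _ _ pow_subst_fun pow_subst_coef0.

Lemma bullet_pow_subst (R : pzRingType) (iota : {rmorphism A -> R}) r :
  bullet iota pow_subst r = wsum (fun a => smap iota (P a)) r.
Proof.
apply: boolp.funext => e; apply: eq_bigr => a _; rewrite [pow_subst _]pow_subst_mon.
by rewrite scoef_smap.
Qed.

End SubstitutionOfPowers.

(** * Adjoining a variable t with t^2 = 0 *)

Section ExtraVariable.
Variable p : nat.
Implicit Types (a b : 'X_{1..p}) (e : 'X_{1..p.+1}).

(** The exponent of s^a t^j, with t placed at index 0. *)
Definition mnm_ext a j : 'X_{1..p.+1} :=
  [multinom if unlift ord0 i is Some i' then a i' else j | i < p.+1].

Definition mnm_tail e : 'X_{1..p} := [multinom e (lift ord0 i) | i < p].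

Lemma mnm_ext0 a j : mnm_ext a j ord0 = j.
Proof. by rewrite mnmE unlift_none. Qed.

Lemma mnm_tailE a j : mnm_tail (mnm_ext a j) = a.
Proof. by apply/mnmP => i; rewrite !mnmE liftK. Qed.

Lemma mnm_extE e : mnm_ext (mnm_tail e) (e ord0) = e.
Proof.
apply/mnmP => i; rewrite mnmE; case: unliftP => [i' ->|->//].
by rewrite mnmE.
Qed.

Lemma mnm_ext_inj a b i j : mnm_ext a i = mnm_ext b j -> a = b /\ i = j.
Proof.
move=> E; split; first by rewrite -(mnm_tailE a i) E mnm_tailE.
by rewrite -(mnm_ext0 a i) E mnm_ext0.
Qed.

Lemma mnm_extD a b i j :
  (mnm_ext a i + mnm_ext b j)%MM = mnm_ext (a + b)%MM (i + j)%N.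
Proof.
by apply/mnmP => l; rewrite !mnmE; case: unliftP => [l' _|_ //]; rewrite mnmE.
Qed.

Lemma mnm_ext00 : mnm_ext 0%MM 0 = 0%MM.
Proof.
by apply/mnmP => l; rewrite !mnmE; case: unliftP => // l' _; rewrite mnm0E.
Qed.

Lemma mdeg_ext a j : mdeg (mnm_ext a j) = (j + mdeg a)%N.
Proof.
rewrite !mdegE big_ord_recl mnm_ext0; congr (_ + _)%N.
by apply: eq_bigr => i _; rewrite mnmE liftK.
Qed.

Variables (Delta : coideal p) (n : nat).

Definition thick_pred e :=
  [&& (e ord0 <= 1)%N, Delta (mnm_tail e) & (mdeg (mnm_tail e) <= n)%N].

Fact thick_nonempty : exists e, thick_pred e.
Proof.
exists (mnm_ext 0%MM 0).
by rewrite /thick_pred mnm_ext0 mnm_tailE coideal0 mdeg0.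
Qed.

Fact thick_down e e' : (e' <= e)%MM -> thick_pred e -> thick_pred e'.
Proof.
move=> le /and3P[e1 De en].
have lt : (mnm_tail e' <= mnm_tail e)%MM.
  by apply/mnm_lepP => i; rewrite !mnmE; exact: (elimT mnm_lepP le).
apply/and3P; split; first exact: leq_trans (elimT mnm_lepP le ord0) e1.
  exact: coideal_down lt De.
by apply: leq_trans en; rewrite -(submK lt) mdegD leq_addl.
Qed.

(* The elements (j, b) with [j <= 1], b in Delta and |b| <= n: the extra
   variable, of index 0, squares to zero, and the bound [n] keeps the set of
   the b's finite. *)
Definition thick : coideal p.+1 := Coideal thick_nonempty thick_down.

Lemma thick_ext a j :
  thick (mnm_ext a j) = [&& (j <= 1)%N, Delta a & (mdeg a <= n)%N].
Proof. by rewrite /= /thick_pred mnm_ext0 mnm_tailE. Qed.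

Section Shift.
Variable R : pzRingType.
Implicit Types f g : series Delta R.

Definition tpow j a : series thick R := smon thick R (mnm_ext a j).

Lemma tpowD i j a b : tpow i a * tpow j b = tpow (i + j) (a + b)%MM.
Proof. by rewrite /tpow smonD mnm_extD. Qed.

Lemma tpow_out j a : ~~ Delta a -> tpow j a = 0.
Proof.
by move=> Da; apply: smon_out; rewrite thick_ext (negbTE Da) /= andbF.
Qed.

Lemma tpow_sq0 j a : (1 < j)%N -> tpow j a = 0.
Proof. by move=> j1; apply: smon_out; rewrite thick_ext leqNgt j1. Qed.

Lemma tpow_order j : order_ge (tpow j).
Proof.
move=> a e ea; have [Te|Te] := boolP (thick e); last by rewrite scoef_out.
rewrite scoef_mon //; case: eqP => // E.
by move: ea; rewrite E mdeg_ext ltnNge leq_addl.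
Qed.

Lemma tpow_comm j a e (x : R) : GRing.comm x (scoef (tpow j a) e).
Proof.
have [Te|Te] := boolP (thick e); last by rewrite scoef_out //; apply: commr0.
by rewrite scoef_mon //; apply: commr_nat.
Qed.

(* f t^j, where t is the extra variable *)
Definition shift j f : series thick R := wsum (tpow j) f.

Lemma scoef_shift i j f b : thick (mnm_ext b i) ->
  scoef (shift j f) (mnm_ext b i) = if i == j then scoef f b else 0.
Proof.
move=> Tb; set e := mnm_ext b i.
have be : (mdeg b < (mdeg e).+1)%N by rewrite ltnS mdeg_ext leq_addl.
rewrite (scoef_wsum _ (@tpow_order j) (leqnn _)) // (bigD1 (BMultinom be)) //=.
rewrite big1 ?addr0 => [|a aNb].
  rewrite scoef_mon //; case: (i =P j) => [ij|ij].
    by rewrite /e ij eqxx mul1r.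
  by case: eqP => [/mnm_ext_inj[_ /ij //]|_]; rewrite mul0r.
rewrite scoef_mon //; case: eqP => [/mnm_ext_inj[ba _]|_]; last by rewrite mul0r.
by case/eqP: aNb; apply: val_inj.
Qed.

Lemma shiftM i j f g : shift i f * shift j g = shift (i + j) (f * g).
Proof.
apply: wsumM; try exact: tpow_order.
- by move=> a b; apply: tpowD.
- by move=> a; apply: tpow_out.
- by move=> b e x; apply: tpow_comm.
Qed.

Lemma shift_sq0 j f : (1 < j)%N -> shift j f = 0.
Proof.
move=> j1; apply: boolp.funext => e.
by rewrite /shift /wsum big1 // => a _; rewrite tpow_sq0 // scoef0 mul0r.
Qed.

Lemma shiftD j f g : shift j (f + g) = shift j f + shift j g.
Proof. exact: wsumDr. Qed.

(** The coefficient of s^b t recovers that of s^b; the bound on |b| is what keeps s^b t nonzero in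
    the truncated ring. *)
Lemma shift1_inj f g b : Delta b -> (mdeg b <= n)%N ->
  shift 1 f = shift 1 g -> scoef f b = scoef g b.
Proof.
move=> Db bn /(congr1 (fun h => scoef h (mnm_ext b 1))).
by rewrite !scoef_shift ?thick_ext ?Db.
Qed.

End Shift.

Lemma smap_tpow (A R : pzRingType) (iota : {rmorphism A -> R}) j a :
  smap iota (tpow A j a) = tpow R j a.
Proof. by apply: boolp.funext => e; rewrite /smap /tpow /smon rmorph_nat. Qed.

(** * The substitutions s_i to s_i, s_i to s_i (1 + t), and s to s^b t *)

Section Substitutions.
Variable A : comPzRingType.

Fact tpow00 : tpow A 0 0%MM = 1.
Proof. by rewrite /tpow mnm_ext00 smon0. Qed.

Definition incl_powers : power_family A Delta thick :=
  PowerFamily tpow00 (@tpowD A 0 0) (@tpow_out A 0) (@tpow_order A 0).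

(* s^a (1 + t)^|a|, as t^2 = 0 *)
Definition dilate_fun a := tpow A 0 a + tpow A 1 a *+ mdeg a.

Fact dilate0 : dilate_fun 0%MM = 1.
Proof. by rewrite /dilate_fun mdeg0 mulr0n addr0 tpow00. Qed.

(** The t^2 term vanishes, and the two terms linear in t add up because |a| + |b| = |a + b|. *)
Fact dilateD a b : dilate_fun a * dilate_fun b = dilate_fun (a + b)%MM.
Proof.
rewrite /dilate_fun mulrDl !mulrDr !mulrnAl !mulrnAr !tpowD.
rewrite [tpow A (1 + 1) _]tpow_sq0 // !mul0rn addr0 mdegD mulrnDr -addrA.
by rewrite [X in _ + X]addrC.
Qed.

Fact dilate_out a : ~~ Delta a -> dilate_fun a = 0.
Proof. by move=> Da; rewrite /dilate_fun !tpow_out // mul0rn addr0. Qed.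

Fact dilate_order : order_ge dilate_fun.
Proof.
by move=> a e ea; rewrite scoefD scoefMn !tpow_order // mul0rn addr0.
Qed.

Definition dilate_powers : power_family A Delta thick :=
  PowerFamily dilate0 dilateD dilate_out dilate_order.

Variable b : 'X_{1..p}.

(** The power (s^b t)^m. It vanishes for m > 1 since t^2 = 0, so the substitution is defined on the
    co-ideal {0, 1}; the factor t gives it positive order even when b = 0. *)
Definition plug_fun (m : 'X_{1..1}) : series thick A :=
  smon thick A (mnm_ext b 1 *+ m ord0)%MM.

Fact plug0 : plug_fun 0%MM = 1.
Proof. by rewrite /plug_fun mnm0E mulm0n smon0. Qed.

Fact plugD (l m : 'X_{1..1}) : plug_fun l * plug_fun m = plug_fun (l + m)%MM.
Proof.
rewrite /plug_fun smonD; congr smon.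
by apply/mnmP => i; rewrite !(mnmDE, mulmnE) mulnDr.
Qed.

Lemma mdeg_ord1 (m : 'X_{1..1}) : mdeg m = m ord0.
Proof. by rewrite mdegE big_ord1. Qed.

Fact plug_out (m : 'X_{1..1}) : ~~ ci01 m -> plug_fun m = 0.
Proof.
rewrite /= mdeg_ord1 => m1; apply: smon_out.
by rewrite /= /thick_pred mulmnE mnm_ext0 mul1n (negbTE m1).
Qed.

Fact plug_order : order_ge plug_fun.
Proof.
move=> m e em; have [Te|Te] := boolP (thick e); last by rewrite scoef_out.
rewrite scoef_mon //; case: eqP => // E; move: em.
by rewrite E mdegMn mdeg_ext mdeg_ord1 mulnC ltnNge leq_pmulr.
Qed.

Definition plug_powers : power_family A ci01 thick :=
  PowerFamily plug0 plugD plug_out plug_order.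

Variables (R : pzRingType) (iota : {rmorphism A -> R}).

Lemma bullet_incl (f : series Delta R) :
  bullet iota (pow_subst incl_powers) f = shift 0 f.
Proof.
rewrite bullet_pow_subst; apply: boolp.funext => e; apply: eq_bigr => a _.
by rewrite /= smap_tpow.
Qed.

(** The factor |a| in the t-part of the image of s^a passes to the coefficient f_a, which produces
    [chi f]. *)
Lemma bullet_dilate (f : series Delta R) :
  bullet iota (pow_subst dilate_powers) f = shift 0 f + shift 1 (chi f).
Proof.
rewrite bullet_pow_subst /shift -wsum_chi -wsumDl.
apply: boolp.funext => e; apply: eq_bigr => a _.
rewrite scoef_smap /= /dilate_fun !scoefD !scoefMn rmorphD rmorphMn.
by rewrite -!(smap_tpow iota) !scoef_smap.
Qed.

Lemma bullet_plug (c : R) :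
  bullet iota (pow_subst plug_powers)
    (1 + sconst ci01 c * svar ci01 R ord0) =
  1 + shift 1 (sconst Delta c * smon Delta R b).
Proof.
have plugR m : smap iota (plug_fun m) = smon thick R (mnm_ext b 1 *+ m ord0)%MM.
  by apply: boolp.funext => e; rewrite /smap /plug_fun /smon rmorph_nat.
rewrite bullet_pow_subst wsumDr.
have order : order_ge (fun m => smap iota (plug_powers m)).
  by move=> m e em; rewrite scoef_smap pow_order // raddf0.
have out m : ~~ ci01 m -> smap iota (plug_powers m) = 0.
  move=> m1; rewrite /= plug_out //; apply: boolp.funext => e.
  by rewrite /smap rmorph0.
congr (_ + _).
  have := wsum_mon 1 order (out 0%MM).
  by rewrite smon0 mulr1 /= plugR mnm0E mulm0n smon0 mul1r.
rewrite /svar wsum_mon //; last exact: out.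
rewrite /shift wsum_mon; [|exact: tpow_order|exact: tpow_out].
by rewrite /= plugR mnm1E eqxx mulm1n.
Qed.

End Substitutions.
End ExtraVariable.
Arguments shift {p Delta} n {R} j f.

(** * Factoring 1 + eps(D) t and applying Psi *)

Section HasseSchmidtStructure.
Variables (k : comPzRingType) (A : comPzAlgType k) (R : pzAlgType k).
Variables (iota : {algmorphism A -> R}) (Psi : hs_structure iota).
Variable nabla : kder A -> R.
Hypothesis nablaE : forall delta : kder A,
  useries_val (Psi 1%N ci01 (hs_of_der delta)) =
  1 + sconst ci01 (nabla delta) * svar ci01 R ord0.
Variables (p : nat) (Delta : coideal p) (D : hasse_schmidt Delta A) (n : nat).

Lemma hs_Psi1 q (Omega : coideal q) : Psi q Omega 1%g = 1%g.
Proof.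
by apply: (mulIg (Psi q Omega 1%g)); rewrite -hs_PsiM !mul1g.
Qed.

Implicit Type l : seq {m : 'X_{1..p} | Delta m}.

(** Written as a finite sum of monomial terms, so that 1 + t times it splits into one factor per
    exponent in [l]. *)
Definition truncated (S : pzRingType) (f : series Delta S) l : series Delta S :=
  \sum_(u <- l) sconst Delta (f u) * smon Delta S (val u).

Lemma scoef_truncated (S : pzRingType) (f : series Delta S) l u :
  uniq l -> u \in l -> scoef (truncated f l) (val u) = f u.
Proof.
move=> l_uniq ul; rewrite scoef_sum (bigD1_seq u) //= scoef_constM.
rewrite scoef_mon ?(valP u) // eqxx mulr1 big1 ?addr0 // => v vu.
rewrite scoef_constM scoef_mon ?(valP u) // eq_sym (inj_eq val_inj).
by rewrite (negbTE vu) mulr0.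
Qed.

Definition hs_plug (u : {m : 'X_{1..p} | Delta m}) :
    hasse_schmidt (thick Delta n) A :=
  hsbullet (pow_subst (plug_powers Delta n A (val u))) (hs_of_der (hs_eps D u)).

Definition hs_plugs l : hasse_schmidt (thick Delta n) A :=
  foldr (fun u E => hs_plug u * E)%g 1%g l.

(** As t^2 = 0, sums of t-parts become products; this holds in noncommutative S too. *)
Lemma shift1_prod (S : pzRingType) (f g : series Delta S) :
  (1 + shift n 1 f) * (1 + shift n 1 g) = 1 + shift n 1 (f + g).
Proof.
rewrite mulrDl mul1r mulrDr mulr1 shiftM [shift n (1 + 1) _]shift_sq0 // addr0.
by rewrite shiftD -addrA [X in _ + X]addrC.
Qed.

Lemma hs_plugsE l :
  useries_val (hs_plugs l) = 1 + shift n 1 (truncated (eps D) l).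
Proof.
elim: l => [|u l IHl]; first by rewrite /truncated big_nil /shift wsum0r addr0.
rewrite /truncated big_cons -shift1_prod -IHl.
(* Read from right to left, [bullet_plug] turns the head factor into the series underlying
   [hs_plug u]. *)
by rewrite -(bullet_plug Delta n (val u) (@kend_mul k A)).
Qed.

(** Psi is multiplicative and commutes with substitutions, so each factor reduces to the image of Id
    + delta s, which [nablaE] gives. *)
Lemma Psi_plugsE l :
  useries_val (Psi _ _ (hs_plugs l)) =
  1 + shift n 1 (truncated (smap nabla (hs_eps D)) l).
Proof.
elim: l => [|u l IHl].
  by rewrite /= hs_Psi1 /truncated big_nil /shift wsum0r addr0.
rewrite /= hs_PsiM hs_Psi_bullet /truncated big_cons -shift1_prod -IHl.
by rewrite useriesM /= nablaE bullet_plug.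
Qed.

Definition bounded_exps : seq {m : 'X_{1..p} | Delta m} :=
  pmap insub [seq val b | b : 'X_{1..p < n.+1}].

Lemma bounded_exps_uniq : uniq bounded_exps.
Proof.
by apply: pmap_sub_uniq; rewrite map_inj_uniq ?enum_uniq //; apply: val_inj.
Qed.

Lemma mem_bounded_exps u : (mdeg (val u) <= n)%N -> u \in bounded_exps.
Proof.
move=> un; rewrite mem_pmap_sub; apply/mapP.
by exists (BMultinom (un : mdeg (val u) < n.+1)%N); rewrite ?mem_enum.
Qed.

(** Only exponents of degree at most n survive in [thick Delta n], and [bounded_exps] lists all of
    those in Delta. *)
Lemma shift1_truncated (S : pzRingType) (f : series Delta S) :
  shift n 1 (truncated f bounded_exps) = shift n 1 f.
Proof.
apply: seriesP => e; rewrite -(mnm_extE e) => Te; rewrite !scoef_shift //.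
case: ifP => // _; move: Te; rewrite thick_ext => /and3P[_ De en].
have -> : mnm_tail e = val (Sub (mnm_tail e) De : {m | Delta m}) by [].
rewrite scoef_truncated ?scoef_val ?bounded_exps_uniq //.
exact: mem_bounded_exps.
Qed.

Lemma chi_eps (S : pzRingType) (r : useries Delta S) :
  chi r = useries_val r * eps r.
Proof. by rewrite /eps mulrA useriesVr mul1r. Qed.

(** This is D + chi(D) t = D (1 + eps(D) t), stated between Hasse-Schmidt derivations so that Psi
    can be applied. *)
Lemma hs_dilateE :
  hsbullet (pow_subst (dilate_powers Delta n A)) D =
  (hsbullet (pow_subst (incl_powers Delta n A)) D * hs_plugs bounded_exps)%g.
Proof.
apply/hasse_schmidtP/useriesP.
rewrite -[RHS]/(useries_val (hs_val (hsbullet _ _)) * useries_val (hs_val _)).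
rewrite hs_plugsE shift1_truncated /= bullet_dilate bullet_incl.
by rewrite mulrDr mulr1 shiftM chi_eps.
Qed.

Lemma chi_Psi b : Delta b -> (mdeg b <= n)%N ->
  scoef (chi (Psi p Delta D)) b =
  scoef (useries_val (Psi p Delta D) * smap nabla (hs_eps D)) b.
Proof.
move=> Db bn; apply: (shift1_inj Db bn).
have := congr1 (fun E => useries_val (Psi _ _ E)) hs_dilateE.
rewrite hs_PsiM !hs_Psi_bullet useriesM Psi_plugsE shift1_truncated /=.
(* Both sides have the same part without t, namely Psi(D); cancelling it leaves the t-parts. *)
by rewrite bullet_dilate bullet_incl mulrDr mulr1 shiftM => /addrI.
Qed.

End HasseSchmidtStructure.

Theorem corollary2p1p10 (k : comPzRingType) (A : comPzAlgType k)
    (R : pzAlgType k) (iota : {algmorphism A -> R}) (Psi : hs_structure iota)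
    (nabla : kder A -> R)
    (nablaE : forall delta : kder A,
      useries_val (Psi 1%N ci01 (hs_of_der delta)) =
      1 + sconst ci01 (nabla delta) * svar ci01 R ord0)
    (p : nat) (p_ge1 : (1 <= p)%N) (Delta : coideal p)
    (D : hasse_schmidt Delta A) :
  eps (Psi p Delta D) = smap nabla (hs_eps D).
Proof.
suff chiE : chi (Psi p Delta D) =
    useries_val (Psi p Delta D) * smap nabla (hs_eps D).
  by rewrite /eps chiE mulrA useriesVl mul1r.
(* Coefficients are compared one at a time, so the degree bound may depend on m. *)
by apply: seriesP => m Dm; apply: (chi_Psi nablaE _ (n := mdeg m)).
Qed.
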